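(* Let $\mathcal{F}$ be an infinite frieze with quiddity row $(a_i)_{i\in\mathbb{Z}}$ such that $a_k=1$ for some integer $k$. Then the sequence $(\check a_i)_{i\in\mathbb{Z}}$ with $$\check a_i=\begin{cases} a_i&\text{if }i\le k-2,\\ a_{k-1}-1&\text{if }i=k-1,\\ a_{k+1}-1&\text{if }i=k,\\ a_{i+1}&\text{if }i\ge k+1,\end{cases}$$ is the quiddity row of an infinite frieze.
   Context: An infinite frieze is an array $(m_{ij})_{i,j\in\mathbb{Z},\,j-i\ge -2}$ of integers with $m_{i,i-2}=0$ and $m_{i,i-1}=1$ for all $i\in\mathbb{Z}$, $m_{ij}>0$ for all $j\ge i$, and $m_{ij}m_{i+1,j+1}-m_{i+1,j}m_{i,j+1}=1$ for all $j-i\ge -1$. Its quiddity row is the sequence $(a_i)_{i\in\mathbb{Z}}$ with $a_i=m_{ii}$. *)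

(* Defs.v *)
From mathcomp Require Import all_boot all_order all_algebra.
Set Implicit Arguments. Unset Strict Implicit. Unset Printing Implicit Defensive.
Import Order.TTheory GRing.Theory Num.Theory.
Local Open Scope ring_scope.

(* The array is encoded as a total function; its entries with j - i < -2,
   which lie outside the frieze, are unconstrained and never used. *)
Record infinite_frieze (m : int -> int -> int) : Prop := InfiniteFrieze {
  frieze_zero_row : forall i : int, m i (i - 2) = 0;
  frieze_one_row : forall i : int, m i (i - 1) = 1;
  frieze_pos : forall i j : int, i <= j -> 0 < m i j;
  frieze_unimodular : forall i j : int, -1 <= j - i ->
    m i j * m (i + 1) (j + 1) - m (i + 1) j * m i (j + 1) = 1
}.

Definition quiddity_row (m : int -> int -> int) : int -> int := fun i => m i i.

Definition reduced_row (a : int -> int) (k : int) : int -> int := fun i =>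
  if i <= k - 2 then a i
  else if i == k - 1 then a (k - 1) - 1
  else if i == k then a (k + 1) - 1
  else a (i + 1).

(* Main.v *)
Require Import Defs.
From mathcomp Require Import all_boot all_order all_algebra.
From mathcomp Require Import zify ring.
Set Implicit Arguments. Unset Strict Implicit. Unset Printing Implicit Defensive.
Import Order.TTheory GRing.Theory Num.Theory.
Local Open Scope ring_scope.

(** Read [m_ij] as the weight of the arc from [i-1] to [j+1] of an infinite
    strip with marked points the integers.  When [a_k = 1], deleting the point
    [k] and renumbering the others gives the required frieze: since arc weights
    satisfy [M(p,k+1) = a_k M(p,k) - M(p,k-1)] and its mirror image, the columns
    (and the rows) [k-1] and [k+1] of [M] form the same 2x2 minors as the
    columns [k-1] and [k]. *)

Definition arc_weight (m : int -> int -> int) (p q : int) : int :=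
  m (p + 1) (q - 1).

Record arc_frieze (M : int -> int -> int) : Prop := ArcFrieze {
  arc_zero : forall p, M p p = 0;
  arc_one : forall p, M p (p + 1) = 1;
  arc_pos : forall p q : int, p < q -> 0 < M p q;
  arc_unimodular : forall p q : int, p < q ->
    M p q * M (p + 1) (q + 1) - M (p + 1) q * M p (q + 1) = 1
}.

Lemma arc_frieze_weight m : infinite_frieze m -> arc_frieze (arc_weight m).
Proof.
case=> m0 m1 mpos mdet; split=> [p|p|p q pq|p q pq]; rewrite /arc_weight.
- by apply: etrans (m0 (p + 1)); congr m; lia.
- by apply: etrans (m1 (p + 1)); congr m; lia.
(* Arcs with [q = p + 1] lie in the row of ones, outside the range of [frieze_pos]. *)
- have [->|q_ne] := eqVneq q (p + 1); last by apply: mpos; lia.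
  by have -> : m (p + 1) (p + 1 - 1) = 1 by apply: m1.
- have := mdet (p + 1) (q - 1) ltac:(lia).
  by have -> : q - 1 + 1 = q + 1 - 1 by lia.
Qed.

Lemma infinite_frieze_arcs M :
  arc_frieze M -> infinite_frieze (fun i j => M (i - 1) (j + 1)).
Proof.
case=> M0 M1 Mpos Mdet; split=> [i|i|i j ij|i j ij].
- by apply: etrans (M0 (i - 1)); congr M; lia.
- by apply: etrans (M1 (i - 1)); congr M; lia.
- by apply: Mpos; lia.
- have := Mdet (i - 1) (j + 1) ltac:(lia).
  by have -> : i - 1 + 1 = i + 1 - 1 by lia.
Qed.

(** Reflecting the strip exchanges rows and columns, so the row recurrence below follows from the
    column one. *)
Lemma arc_frieze_mirror M : arc_frieze M -> arc_frieze (fun p q => M (- q) (- p)).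
Proof.
case=> M0 M1 Mpos Mdet; split=> [p|p|p q pq|p q pq].
- exact: M0.
- by apply: etrans (M1 (- (p + 1))); congr M; lia.
- by apply: Mpos; lia.
- have := Mdet (- (q + 1)) (- (p + 1)) ltac:(lia).
  have -> : - (q + 1) + 1 = - q by lia.
  have -> : - (p + 1) + 1 = - p by lia.
  by move=> det; rewrite -[RHS]det; ring.
Qed.

(** Induction on the distance from [p] up to [r - 1]: two adjacent unimodular rules carry the
    relation from row [s] to row [s - 1], and [M s r > 0] can be cancelled. *)
Lemma arc_recurrence_r (M : int -> int -> int) (r p : int) :
  arc_frieze M -> p < r ->
  M p (r + 1) = M (r - 1) (r + 1) * M p r - M p (r - 1).
Proof.
case=> M0 M1 Mpos Mdet p_lt_r.
have {p_lt_r} [n ->] : exists n : nat, p = r - 1 - n%:Z.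
  by exists `|(r - 1 - p)%R|%N; lia.
elim: n => [|n IHn].
  have := M1 (r - 1); rewrite subr0 subrK => ->.
  by rewrite M0; ring.
set s := r - 1 - n%:Z in IHn *.
have -> : r - 1 - n.+1%:Z = s - 1 by lia.
have Msr_gt0 : 0 < M s r by apply: Mpos; lia.
have := Mdet (s - 1) (r - 1) ltac:(lia).
have := Mdet (s - 1) r ltac:(lia).
rewrite !subrK IHn => det1 det2.
apply: (mulfI (lt0r_neq0 Msr_gt0)).
(* Subtracting the two unimodular rules gives [M s r] times the recurrence. *)
have det21 := congr2 (fun x y => x - y) det2 det1; rewrite /= subrr in det21.
by apply/eqP; rewrite -subr_eq0; apply/eqP; rewrite -[RHS]det21; ring.
Qed.

Lemma arc_recurrence_l (M : int -> int -> int) (r q : int) :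
  arc_frieze M -> r < q ->
  M (r - 1) q = M (r - 1) (r + 1) * M r q - M (r + 1) q.
Proof.
move=> /arc_frieze_mirror Mfr r_lt_q.
have := @arc_recurrence_r _ (- r) (- q) Mfr ltac:(lia).
rewrite !opprK.
have -> : - (- r + 1) = r - 1 by lia.
by have -> : - (- r - 1) = r + 1 by lia.
Qed.

(** The increasing bijection from the integers onto the integers other than [k]. *)
Definition skip (k p : int) : int := if p < k then p else p + 1.

Ltac skip_lia :=
  rewrite /skip;
  repeat match goal with |- context [if ?b then _ else _] => case: (boolP b) end;
  lia.

Lemma skip_arc_frieze (M : int -> int -> int) (k : int) :
  arc_frieze M -> M (k - 1) (k + 1) = 1 ->
  arc_frieze (fun p q => M (skip k p) (skip k q)).
Proof.
move=> Mfr Mk1; have [M0 M1 Mpos Mdet] := Mfr.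
have skipS (p : int) : p != k - 1 -> skip k (p + 1) = skip k p + 1.
  by skip_lia.
have skip_jump : skip k (k - 1 + 1) = k + 1 by skip_lia.
have skip_pred : skip k (k - 1) = k - 1 by skip_lia.
have skip_mono (p q : int) : p < q -> skip k p < skip k q by skip_lia.
split=> [p|p|p q /skip_mono|p q pq] //.
(* The arc over the deleted point has weight 1 by [Mk1]. *)
- have [->|pk] := eqVneq p (k - 1); first by rewrite skip_jump skip_pred.
  by rewrite skipS.
- exact: Mpos.
(* Row [k - 1] is row [k] minus row [k + 1], so the minor equals that of rows [k] and [k + 1]. *)
have [p_eq|pk] := eqVneq p (k - 1).
  rewrite p_eq skip_jump skip_pred skipS; last by lia.
  set s := skip k q; have s_gt : k < s by rewrite /s; skip_lia.
  rewrite (arc_recurrence_l Mfr s_gt) (@arc_recurrence_l M k (s + 1)) // ?Mk1.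
    by rewrite -[RHS](Mdet k s s_gt); ring.
  by lia.
(* Column [k + 1] is column [k] minus column [k - 1], so the minor equals that of columns [k - 1]
   and [k]. *)
have [q_eq|qk] := eqVneq q (k - 1).
  rewrite q_eq skip_jump skip_pred skipS //.
  set s := skip k p; have s_lt : s < k - 1 by rewrite /s; skip_lia.
  rewrite (@arc_recurrence_r M k s) ?(@arc_recurrence_r M k (s + 1)) // ?Mk1;
    try lia.
  by have := Mdet s (k - 1) s_lt; rewrite subrK => det; rewrite -[RHS]det; ring.
by rewrite !skipS // Mdet //; apply: skip_mono.
Qed.

Theorem theorem2p7 (m : int -> int -> int) (a : int -> int) (k : int) :
  infinite_frieze m ->
  (forall i : int, a i = quiddity_row m i) ->
  a k = 1 ->
  exists m' : int -> int -> int,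
    infinite_frieze m' /\
    (forall i : int, reduced_row a k i = quiddity_row m' i).
Proof.
move=> /arc_frieze_weight; set M := arc_weight m => Mfr a_m ak1.
have aE i : a i = M (i - 1) (i + 1).
  by rewrite a_m /quiddity_row /M /arc_weight subrK addrK.
have Mk1 : M (k - 1) (k + 1) = 1 by rewrite -aE.
have M1 := arc_one Mfr.
exists (fun i j => M (skip k (i - 1)) (skip k (j + 1))); split.
  exact: (infinite_frieze_arcs (skip_arc_frieze Mfr Mk1)).
move=> i; rewrite /quiddity_row /reduced_row.
case: ifP => [i_le|i_gt].
  by rewrite aE; congr M; skip_lia.
case: eqP => [->|i_ne1].
  have -> : skip k (k - 1 - 1) = k - 1 - 1 by skip_lia.
  have -> : skip k (k - 1 + 1) = k + 1 by skip_lia.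
  (* [M (k - 2) (k + 1) = M (k - 2) k - M (k - 2) (k - 1)], which is [a (k - 1) - 1]. *)
  rewrite (@arc_recurrence_r M k) ?Mk1 //; last by lia.
  have := M1 (k - 1 - 1); rewrite subrK => ->.
  by rewrite aE subrK mul1r.
case: eqP => [->|i_nek].
  have -> : skip k (k - 1) = k - 1 by skip_lia.
  have -> : skip k (k + 1) = k + 1 + 1 by skip_lia.
  (* [M (k - 1) (k + 2) = M k (k + 2) - M (k + 1) (k + 2)], which is [a (k + 1) - 1]. *)
  rewrite (@arc_recurrence_l M k) ?Mk1 //; last by lia.
  by rewrite M1 aE addrK mul1r.
by rewrite aE; congr M; skip_lia.
Qed.
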